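(* Let $X$ be a real Banach space and let $K$ be a nonempty closed subset of $X$. Then $K$ is convex if any one of the following conditions holds: (i) $X$ has uniformly smooth norm and $K$ is an almost sun. (ii) $X$ is LUR with rotund dual $X^*$, the distance function $d_K$ is uniformly smooth on the set $E_r(K)$ for some $r>0$ for which $E_r(K)$ is dense in $X\setminus K$, and $\|d_K'(x)\|=1$ for all $x\in X\setminus K$. (iii) $X$ has LUR and Fréchet smooth norm with rotund dual $X^*$, and the distance function $d_K$ is uniformly Fréchet smooth on the set $E_r(K)$ for some $r>0$ for which $E_r(K)$ is dense in $X\setminus K$.
   Context: For a nonempty closed set $K\subset X$, $d_K(x)=\inf\{\|x-k\|: k\in K\}$ and $P_K(x)=\{k\in K:\|x-k\|=d_K(x)\}$. $E(K)$ is the set of $x\in X\setminus K$ with $P_K(x)\neq\emptyset$. For $r>0$, $$E_r(K)=\left\{ x_0-r\,\frac{x_0-p(x_0)}{\|x_0-p(x_0)\|} : x_0\in E(K),\ p(x_0)\in P_K(x_0),\ \|x_0-p(x_0)\|=d_K(x_0)>r\right\}.$$ $K$ is almost proximinal if $P_K(x)\ne\emptyset$ for a dense set of $x\in X\setminus K$. A point $x\in X\setminus K$ is a solar point of $K$ if there is $p(x)\in P_K(x)$ such that $p(x)\in P_K(x+t(x-p(x)))$ for all $t\ge0$. An almost proximinal set $K$ is an almost sun if the set of its solar points is dense in $X\setminus K$. Rotund means strictly convex. $X$ (its norm) is LUR if for every $x\in X$ with $\|x\|=1$ and every sequence $(y_n)$ with $\|y_n\|\le 1$ and $\|\frac{y_n+x}{2}\|\to1$,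 one has $y_n\to x$. A function $h:X\to\mathbb R$ is smooth (Gâteaux differentiable) at $x$, with Gâteaux derivative $h'(x)\in X^*$, if for every $\epsilon>0$ and $y\in X$ with $\|y\|=1$ there is $\delta(\epsilon,x,y)>0$ with $$\left|\frac{h(x+ty)-h(x)}{t}-h'(x)(y)\right|<\epsilon\quad\text{when } 0<|t|<\delta. \qquad ( * )$$ It is Fréchet smooth at $x$ if $\delta=\delta(\epsilon,x)$ can be chosen so that $( * )$ holds for all unit $y$. It is uniformly smooth on a set $D$ if it is smooth at each point of $D$ and $\delta=\delta(\epsilon,y)$ can be chosen so that $( * )$ holds for all $x\in D$; it is uniformly Fréchet smooth on $D$ if $\delta=\delta(\epsilon)$ can be chosen so that $( * )$ holds for all $x\in D$ and all unit $y$. The norm is Fréchet smooth if it is so at every nonzero point; the norm is uniformly smooth if the function $h=\|\cdot\|$ is uniformly smooth on the unit sphere $D=\{x:\|x\|=1\}$ in the Gâteaux sense, i.e. $h=\|\cdot\|$ is Gâteaux differentiable at each $x$ with $\|x\|=1$ and for every $\epsilon>0$ and every unit $y$ there is $\delta=\delta(\epsilon,y)>0$, independent of $x$, such that $\left|\frac{\|x+ty\|-\|x\|}{t}-h'(x)(y)\right|<\epsilon$ whenever $\|x\|=1$ and $0<|t|<\delta$. $d_K'(x)$ denotes the Gâteaux derivative of $d_K$ at $x$. *)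

(* Defs.v *)
From HB Require Import structures.
From mathcomp Require Import all_boot all_order all_algebra.
From mathcomp Require Import all_classical all_reals all_analysis.
Set Implicit Arguments.
Unset Strict Implicit.
Unset Printing Implicit Defensive.
Import Order.TTheory GRing.Theory Num.Theory.
Import numFieldNormedType.Exports.
Local Open Scope classical_set_scope.
Local Open Scope ring_scope.

Section Duality.
Context {R : realType} {X : normedModType R}.

(* The dual X^* as a set of plain functions, so that equality of functionals
   is equality of functions. *)
Definition dual : set (X -> R^o) := [set f | linear f /\ continuous f].

Definition dual_norm (f : X -> R^o) : R :=
  sup [set `|f x| | x in [set x : X | `|x| <= 1]].

End Duality.

Section Geometry.
Context {R : realType} (X : normedModType R).

Definition rotund_dual : Prop :=
  forall f g : X -> R^o, dual f -> dual g ->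
    dual_norm f = 1 -> dual_norm g = 1 -> f <> g ->
    dual_norm (fun x => 2^-1 * (f x + g x)) < 1.

Definition LUR : Prop :=
  forall (x : X) (y : nat -> X),
    `|x| = 1 -> (forall n, `|y n| <= 1) ->
    (fun n => `|2^-1 *: (y n + x)|) @ \oo --> (1 : R) ->
    y @ \oo --> x.

End Geometry.

Section Smoothness.
Context {R : realType} {X : normedModType R}.
Implicit Types (h : X -> R) (x y : X) (f : X -> R^o) (D : set X).

Definition diff_quot_close h x f (eps : R) y (delta : R) : Prop :=
  forall t : R, 0 < `|t| < delta ->
    `|(h (x + t *: y) - h x) / t - f y| < eps.

Definition gateaux_derivative h x f : Prop :=
  dual f /\
  forall (eps : R) y, 0 < eps -> `|y| = 1 ->
    exists2 delta : R, 0 < delta & diff_quot_close h x f eps y delta.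

Definition frechet_smooth h x : Prop :=
  exists2 f, gateaux_derivative h x f &
  forall eps : R, 0 < eps ->
    exists2 delta : R, 0 < delta &
      forall y, `|y| = 1 -> diff_quot_close h x f eps y delta.

(* h' selects a Gateaux derivative at each point of D; there is only one. *)
Definition uniformly_smooth_on D h : Prop :=
  exists2 h' : X -> X -> R^o,
    forall x, D x -> gateaux_derivative h x (h' x) &
    forall (eps : R) y, 0 < eps -> `|y| = 1 ->
      exists2 delta : R, 0 < delta &
        forall x, D x -> diff_quot_close h x (h' x) eps y delta.

Definition uniformly_frechet_smooth_on D h : Prop :=
  exists2 h' : X -> X -> R^o,
    forall x, D x -> gateaux_derivative h x (h' x) &
    forall eps : R, 0 < eps ->
      exists2 delta : R, 0 < delta &
        forall x y, D x -> `|y| = 1 -> diff_quot_close h x (h' x) eps y delta.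

End Smoothness.

Section NormSmoothness.
Context {R : realType} (X : normedModType R).

Definition frechet_smooth_norm : Prop :=
  forall x : X, x != 0 -> frechet_smooth (fun z : X => `|z|) x.

Definition uniformly_smooth_norm : Prop :=
  uniformly_smooth_on [set x : X | `|x| = 1] (fun z : X => `|z|).

End NormSmoothness.

Section BestApproximation.
Context {R : realType} {X : normedModType R}.
Implicit Types (K : set X) (x : X).

Definition dist K x : R := inf [set `|x - k| | k in K].

Definition proj K x : set X := [set k | K k /\ `|x - k| = dist K x].

Definition Eset K : set X := [set x | ~ K x /\ proj K x !=set0].

Definition Erset (r : R) K : set X :=
  [set z | exists x0 p : X,
    [/\ Eset K x0, proj K x0 p, `|x0 - p| = dist K x0, r < dist K x0 &
        z = x0 - r *: (`|x0 - p|^-1 *: (x0 - p))]].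

(* S meets every nonempty open subset of A, for A open (here A = ~` K). *)
Definition dense_in (S A : set X) : Prop := A `<=` closure S.

Definition almost_proximinal K : Prop := dense_in (Eset K) (~` K).

Definition solar_points K : set X :=
  [set x | ~ K x /\
    exists2 p, proj K x p &
      forall t : R, 0 <= t -> proj K (x + t *: (x - p)) p].

Definition almost_sun K : Prop :=
  almost_proximinal K /\ dense_in (solar_points K) (~` K).

End BestApproximation.

(* Main.v *)
(* A solar point x has the open half space {f > f x - d_K x} disjoint from K,
   where f is the derivative of the norm at x - p(x); density of solar points
   then separates every point outside K from K. This gives (i).
   In (ii) and (iii), let x lie outside K. Each point of E_r(K)
   starts a segment of length r along which d_K grows at unit rate. By density,
   starting from x, one obtains nested balls disjoint from K whose radii tend to
   infinity (Vlasov). By Hahn-Banach each point of K is separated from all these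
   balls by a functional of norm one. The balls being nested and unbounded,
   the mean of two such functionals still has norm one, so rotundity of the
   dual forces all of them to coincide, and x is separated from K. *)
From HB Require Import structures.
Require Import Defs.
From mathcomp Require Import all_boot all_order all_algebra.
From mathcomp Require Import all_classical all_reals all_analysis.
From mathcomp Require Import ring lra.
Set Implicit Arguments.
Unset Strict Implicit.
Unset Printing Implicit Defensive.
Import Order.TTheory GRing.Theory Num.Theory.
Import numFieldNormedType.Exports.
Local Open Scope classical_set_scope.
Local Open Scope ring_scope.

(** * The Hahn-Banach theorem for sublinear functionals *)

Section HahnBanach.
Context {R : realType}.

Lemma le_infD (A B : set R) (m : R) : A !=set0 -> B !=set0 ->
  (forall a b, A a -> B b -> m <= a + b) -> m <= inf A + inf B.
Proof.
move=> A0 B0 mAB; rewrite -lerBlDr; apply: lb_le_inf => // a Aa.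
rewrite lerBlDr addrC -lerBlDr; apply: lb_le_inf => // b Bb.
by rewrite lerBlDr addrC mAB.
Qed.

Context {V : lmodType R}.

(** Homogeneity is only an inequality for positive factors, which is easy to check for infima;
    scaling back by [t^-1] yields equality in [sublinearZ]. *)
Definition sublinear (p : V -> R) : Prop :=
  (forall x y, p (x + y) <= p x + p y) /\
  (forall t x, 0 < t -> p (t *: x) <= t * p x).

Lemma sublinear0 p : sublinear p -> p 0 = 0.
Proof.
move=> [pD pZ]; apply/eqP; rewrite eq_le; apply/andP; split.
  by have := pZ 2^-1 0 ltac:(lra); rewrite scaler0; lra.
by have := pD 0 0; rewrite addr0; lra.
Qed.

Lemma sublinearZ p t x : sublinear p -> 0 <= t -> p (t *: x) = t * p x.
Proof.
move=> sp; rewrite le_eqVlt => /predU1P[<-|t0].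
  by rewrite scale0r mul0r sublinear0.
apply/eqP; rewrite eq_le sp.2 //= -ler_pdivlMl //.
have := sp.2 t^-1 (t *: x); rewrite invr_gt0 scalerA mulVf ?scale1r ?gt_eqF //.
exact.
Qed.

Lemma sublinear_geN p x : sublinear p -> - p (- x) <= p x.
Proof. by move=> sp; have := sp.1 x (- x); rewrite subrr sublinear0 //; lra. Qed.

Lemma sublinear_inf (I : Type) (D : set I) (F : I -> V -> R) :
  D !=set0 ->
  (forall x, has_lbound [set F i x | i in D]) ->
  (forall i j x y, D i -> D j ->
     exists2 k, D k & F k (x + y) <= F i x + F j y) ->
  (forall i t x, D i -> 0 < t -> exists2 k, D k & F k (t *: x) <= t * F i x) ->
  sublinear (fun x => inf [set F i x | i in D]).
Proof.
move=> [i0 Di0] Flb FD FZ.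
have ne x : [set F i x | i in D] !=set0 by exists (F i0 x), i0.
split=> [x y|t x t0].
  apply: le_infD => // _ _ [i Di <-] [j Dj <-].
  have [k Dk] := FD i j x y Di Dj; apply: le_trans.
  by apply: ge_inf => //; exists k.
rewrite -ler_pdivrMl //; apply: lb_le_inf => // _ [i Di <-].
rewrite ler_pdivrMl //; have [k Dk] := FZ i t x Di t0; apply: le_trans.
by apply: ge_inf => //; exists k.
Qed.

(** Zorn's lemma for the reversed pointwise order: a nonempty chain is bounded by its pointwise
    infimum, which is finite because every member is at least [- p (- x)] at [x]. *)
Lemma minimal_sublinear (p : V -> R) : sublinear p ->
  exists q, [/\ sublinear q, forall x, q x <= p x &
    forall q', sublinear q' -> (forall x, q' x <= q x) -> q' = q].
Proof.
move=> sp; pose P (q : V -> R) := sublinear q /\ forall x, q x <= p x.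
pose T := {q | P q}.
pose below (a b : T) := `[< forall x, sval b x <= sval a x >].
have p0 : T by exists p.
have [||A totA|[q [sq qp]] /= minq] := @ZL_preorder T p0 below.
- by move=> a; apply/asboolP.
- move=> b a c /asboolP ab /asboolP bc; apply/asboolP => x.
  exact: le_trans (bc x) (ab x).
- have [[a0 Aa0]|A0] := pselect (A !=set0); last first.
    by exists p0 => s As; case: A0; exists s.
  have lb x : has_lbound [set sval a x | a in A].
    exists (- p (- x)) => _ [[a [sa ap]] Aa <-] /=.
    by rewrite (le_trans _ (sublinear_geN x sa)) // lerN2.
  have sinf : sublinear (fun x => inf [set sval a x | a in A]).
    apply: sublinear_inf => //; first by exists a0.
      move=> a b x y Aa Ab; case: (totA a b Aa Ab) => /asboolP ab.
        exists b => //; apply: le_trans ((svalP b).1.1 x y) _.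
        by rewrite lerD2r.
      exists a => //; apply: le_trans ((svalP a).1.1 x y) _.
      by rewrite lerD2l.
    by move=> a t x Aa t0; exists a => //; exact: (svalP a).1.2.
  have infp x : inf [set sval a x | a in A] <= p x.
    apply: le_trans ((svalP a0).2 x); apply: ge_inf => //; by exists a0.
  exists (exist P _ (conj sinf infp)) => a Aa; apply/asboolP => x /=.
  by apply: ge_inf => //; exists a.
exists q; split=> // q' sq' q'q.
have q'p x : q' x <= p x by exact: le_trans (q'q x) (qp x).
have /asboolP /= qq' := minq (exist P _ (conj sq' q'p))
  (introT (asboolP _) q'q).
by apply/funext => x; apply/eqP; rewrite eq_le q'q qq'.
Qed.

(* König's form of the Hahn-Banach theorem. If [p] is minimal, it equals
   [w |-> inf_(t >= 0) (p (w + t *: a) - t * p a)], so that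
   [p w <= p (w + a) - p a]. *)
Lemma hahn_banach (p : V -> R) : sublinear p ->
  exists2 f : V -> R^o, linear f & forall x, f x <= p x.
Proof.
move=> /minimal_sublinear[f [sf fp minf]]; exists f => //.
have fD a w : f w + f a = f (w + a).
  apply/eqP; rewrite eq_le sf.1 andbT.
  pose F t w := f (w + t *: a) - t * f a.
  have lb x : has_lbound [set F t x | t in [set t | 0 <= t]].
    exists (- f (- x)) => _ [t /= t0 <-]; rewrite /F -sublinearZ //.
    have := sf.1 (x + t *: a) (- x); rewrite addrAC subrr add0r; lra.
  have sF : sublinear (fun x => inf [set F t x | t in [set t | 0 <= t]]).
    apply: sublinear_inf => //; first by exists 0 => /=.
      move=> t s x y /= t0 s0; exists (t + s) => /=; first exact: addr_ge0.
      have := sf.1 (x + t *: a) (y + s *: a).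
      by rewrite /F addrACA -scalerDl; lra.
    move=> t s x /= t0 s0; exists (s * t) => /=; first by rewrite mulr_ge0 // ltW.
    rewrite /F -scalerA -scalerDr.
    by have := sf.2 s (x + t *: a) s0; lra.
  have le0 x t : 0 <= t -> inf [set F t x | t in [set t | 0 <= t]] <= F t x.
    by move=> t0; apply: ge_inf => //; exists t.
  have infF : (fun x => inf [set F t x | t in [set t | 0 <= t]]) = f.
    apply: (minf _ sF) => x.
    by rewrite (le_trans (le0 x 0 _)) // /F scale0r mul0r subr0 addr0.
  have := le0 w 1 ler01; rewrite [X in X <= _](congr1 (@^~ w) infF).
  by rewrite /F scale1r mul1r; lra.
have fN x : f (- x) = - f x.
  by have := fD (- x) x; rewrite subrr sublinear0 //; lra.
move=> t x y /=; rewrite -fD; congr (_ + _).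
have [t0|t0] := leP 0 t; first exact: sublinearZ.
rewrite -[t *: x]opprK fN -scaleNr sublinearZ ?oppr_ge0 1?ltW //.
by rewrite mulNr opprK.
Qed.

End HahnBanach.

(** * Linear functionals of norm one *)

Section Functionals.
Context {R : realType} {X : normedModType R}.
Implicit Types (f : X -> R^o) (x y z : X) (K : set X).

Lemma linear_bundle f : linear f -> exists g : {linear X -> R^o}, f = g.
Proof.
move=> lf; pose fM := GRing.isLinear.Build _ _ _ _ f lf.
pose g : {linear X -> R^o} := HB.pack f fM.
by exists g.
Qed.

Lemma norm_le1_dual f : linear f -> (forall x, f x <= `|x|) -> dual f.
Proof.
move=> lf; have [g ->] := linear_bundle lf => g1; split.
  by move=> a x y; rewrite linearP.
apply: bounded_linear_continuous; apply/linear_boundedP; near=> M => x.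
have M1 : 1 <= M by near: M; exact: nbhs_pinfty_ge.
have gx : `|g x| <= `|x|.
  by rewrite ler_norml lerNl -linearN -[X in g _ <= X]normrN !g1.
by rewrite (le_trans gx) // ler_peMl.
Unshelve. all: by end_near. Qed.

(** The supremum need not be attained, so vectors that norm [f] up to any [e] are enough. *)
Lemma dual_norm_eq1 f : linear f -> (forall x, f x <= `|x|) ->
  (forall e, 0 < e -> exists2 v, `|v| <= 1 & 1 - e <= f v) -> dual_norm f = 1.
Proof.
move=> lf; have [g ->] := linear_bundle lf => g1 gv.
have ub : ubound [set `|g x| | x in [set x : X | `|x| <= 1]] 1.
  move=> _ [x /= x1 <-]; apply: le_trans x1.
  by rewrite ler_norml lerNl -linearN -[X in g _ <= X]normrN !g1.
apply/eqP; rewrite eq_le; apply/andP; split.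
  by apply: ge_sup => //; exists `|g 0|, 0 => //=; rewrite normr0.
apply/ler_addgt0Pr => e e0; have [v v1 gve] := gv e e0.
rewrite -lerBlDr (le_trans gve) // (le_trans (ler_norm _)) //.
by apply: ub_le_sup; [exists 1 | exists v].
Qed.

Lemma convex_setP K :
  (forall k1 k2 (t : R), K k1 -> K k2 -> 0 <= t -> t <= 1 ->
     K (t *: k1 + (1 - t) *: k2)) -> convex_set K.
Proof.
move=> cK k1 k2 t; rewrite !inE => Kk1 Kk2.
exact: (cK k1 k2 t%:num Kk1 Kk2 (ge0 t) (le1 t)).
Qed.

End Functionals.

(** * The distance function to a set *)

Section Distance.
Context {R : realType} {X : normedModType R}.
Variable K : set X.
Implicit Types x y z k : X.

Lemma dist_le_norm x k : K k -> dist K x <= `|x - k|.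
Proof.
by move=> Kk; apply: ge_inf; [exists 0 => _ [? _ <-] | exists k].
Qed.

Hypothesis K_nonempty : K !=set0.

Lemma dist_lipschitz x y : dist K x <= `|x - y| + dist K y.
Proof.
have [k0 Kk0] := K_nonempty.
rewrite -lerBlDl; apply: lb_le_inf; first by exists `|y - k0|, k0.
move=> _ [k Kk <-]; rewrite lerBlDl.
by rewrite (le_trans (dist_le_norm x Kk)) // ler_distD.
Qed.

Hypothesis K_closed : closed K.

Lemma dist_gt0 x : ~ K x -> 0 < dist K x.
Proof.
have [k0 Kk0] := K_nonempty.
have := closed_openC K_closed; rewrite openE => oK /oK.
move=> /nbhs_ballP[e /= e0 eK]; apply: lt_le_trans e0 _.
apply: lb_le_inf; first by exists `|x - k0|, k0.
move=> _ [k Kk <-]; rewrite leNgt; apply/negP => xk.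
by apply: (eK k) => //; rewrite -ball_normE.
Qed.

End Distance.

Lemma dense_in_near {R : realType} {X : normedModType R} {S A : set X}
  (x : X) (e : R) : dense_in S A -> A x -> 0 < e -> exists2 z, S z & `|x - z| < e.
Proof.
move=> SA /SA clx e0; have [z [Sz]] := clx _ (nbhsx_ballx x e e0).
by rewrite -ball_normE; exists z.
Qed.

(** * Solar points and supporting half spaces *)

Section Solar.
Context {R : realType} {X : normedModType R}.
Implicit Types (h : X -> R) (u v x : X) (f : X -> R^o) (K : set X).

(** A lower growth rate passes to the limit of difference quotients. The derivative is tested on
    unit vectors only, so [v] is rescaled by its norm. *)
Lemma gateaux_derivative_ge h u f v (c r : R) :
  gateaux_derivative h u f -> 0 < r ->
  (forall t, 0 < t < r -> c * t <= h (u + t *: v) - h u) -> c <= f v.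
Proof.
move=> [[lf _] fh] r0 hv.
have [g gf] := linear_bundle lf; rewrite gf in fh *.
have [v0|v0] := eqVneq v 0.
  have := hv (r / 2) ltac:(by apply/andP; split; lra).
  by rewrite v0 linear0 linear0 addr0 subrr; nra.
have n0 : 0 < `|v| by rewrite normr_gt0.
have n1 : `| `|v|^-1 *: v | = 1.
  by rewrite normrZ normfV normr_id mulVf // gt_eqF.
apply/ler_addgt0Pr => e e0.
have [d d0 dq] := fh (e / `|v|) _ (divr_gt0 e0 n0) n1.
pose t := Num.min (d / 2 / `|v|) (r / 2).
have t0 : 0 < t by rewrite lt_min !divr_gt0.
have td : t * `|v| < d.
  apply: (@le_lt_trans _ _ (d / 2)); last by lra.
  by rewrite -ler_pdivlMr // /t ge_min lexx.
have tr : t < r.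
  apply: (@le_lt_trans _ _ (r / 2)); last by lra.
  by rewrite /t ge_min lexx orbT.
have tv0 : 0 < t * `|v| by rewrite mulr_gt0.
have := dq (t * `|v|); rewrite gtr0_norm // tv0 td => /(_ isT).
rewrite scalerA mulfK ?gt_eqF // linearZ /= -[_ *: g v]/(_ * g v).
have := hv t ltac:(by rewrite t0).
move: (h _ - h _) => q cq /ltr_normlW.
rewrite invfM mulrA -[`|v|^-1 * _]mulrC -mulrBl ltr_pM2r ?invr_gt0 //.
have : c <= q / t by rewrite ler_pdivlMr.
lra.
Qed.

(* Along the solar ray the balls of centre [x + s *: (x - p)] that touch [K] at
   [p] exhaust the open half space [f > f p], [f] being the derivative of the
   norm at the direction of [x - p]. *)
Lemma solar_point_support K x : K !=set0 -> closed K ->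
  uniformly_smooth_norm X -> solar_points K x ->
  exists f : X -> R^o, [/\ linear f, forall w, f w <= `|w| &
    forall k, K k -> f k <= f x - dist K x].
Proof.
move=> K0 Kc [h' dh' _] [nKx [p [Kp xpd] solar]].
have d0 := dist_gt0 K0 Kc nKx; set d := dist K x in d0 xpd *.
have [u uE] : exists u, u = d^-1 *: (x - p) by eexists.
have u1 : `|u| = 1 by rewrite uE normrZ normfV xpd gtr0_norm // mulVf // gt_eqF.
have {dh'} du := dh' u u1; exists (h' u); have [[lf _] _] := du.
move: (h' u) du lf => f du lf; have [g gf] := linear_bundle lf.
have f1 w : f w <= `|w|.
  (* By the triangle inequality the norm decreases from [u] along [- w] at rate at most the norm of
     [w]. *)
  rewrite gf -lerN2 -linearN -gf.
  apply: (gateaux_derivative_ge du ltr01) => t /andP[t0 t1].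
  have := lerB_normD u (t *: - w); rewrite normrZ normrN gtr0_norm //; lra.
split=> // k Kk.
have fpk : 0 <= f (p - k).
  have d10 : 0 < d^-1 by rewrite invr_gt0.
  apply: (gateaux_derivative_ge du d10) => t /andP[t0 td].
  (* At this ray parameter the point minus [p] is [t^-1 *: u], and minus [k] it is
     [t^-1 *: (u + t *: (p - k))]. As [p] is nearest there, the norm does not drop from [u] to
     [u + t *: (p - k)]. *)
  have s0 : 0 <= (t * d)^-1 - 1.
    rewrite subr_ge0 -[1]invr1 lef_pV2 ?posrE ?mulr_gt0 //.
    by rewrite -ler_pdivlMr // div1r ltW.
  have [_ solt] := solar _ s0.
  have := dist_le_norm (x + ((t * d)^-1 - 1) *: (x - p)) Kk.
  rewrite -solt.
  have -> : x + ((t * d)^-1 - 1) *: (x - p) - p = (t * d)^-1 *: (x - p).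
    by rewrite addrAC scalerBl scale1r addrC subrK.
  have -> : x + ((t * d)^-1 - 1) *: (x - p) - k = t^-1 *: (u + t *: (p - k)).
    rewrite uE.
    rewrite scalerBl scale1r [RHS]scalerDr !scalerA mulVf ?gt_eqF // scale1r -invfM.
    by rewrite addrCA -addrA opprB [x + (p - x)]addrC subrK.
  rewrite !normrZ xpd u1 !normfV (gtr0_norm t0) gtr0_norm ?mulr_gt0 //.
  rewrite invfM -mulrA mulVf ?gt_eqF // ler_pM2l ?invr_gt0 //; lra.
have fu : 1 <= f u.
  apply: (gateaux_derivative_ge du ltr01) => t /andP[t0 _].
  rewrite -{1}[u]scale1r -scalerDl normrZ u1 gtr0_norm ?addr_gt0 //; lra.
have fxp : d <= f (x - p).
  move: fu; rewrite uE gf linearZ /= -[_ *: g _]/(_ * g _).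
  by rewrite ler_pdivlMl // mulr1.
by move: fxp fpk; rewrite gf !linearB /=; lra.
Qed.

Lemma almost_sun_convex K : K !=set0 -> closed K ->
  uniformly_smooth_norm X -> dense_in (solar_points K) (~` K) -> convex_set K.
Proof.
move=> K0 Kc us dK; apply: convex_setP => k1 k2 t Kk1 Kk2 t0 t1.
set x := (X in K X); apply: contrapT => nKx.
have d0 := dist_gt0 K0 Kc nKx.
(* With [d] the distance from [x] to [K], that of [z] exceeds [3 d / 4]. Averaging the bounds at
   [k1] and [k2] gives [f (z - x) >= 3 d / 4], but [z - x] has norm below [d / 4]. *)
have [z sz xz] := dense_in_near dK nKx (divr_gt0 d0 (ltr0Sn R 3)).
have [f [lf f1 fK]] := solar_point_support K0 Kc us sz.
have := f1 (z - x); have := dist_lipschitz K0 x z.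
have := fK k1 Kk1; have := fK k2 Kk2; rewrite [`|z - x|]distrC.
have [g ->] := linear_bundle lf; rewrite !linearB /=.
have -> : g x = t * g k1 + (1 - t) * g k2 by rewrite /x linearD !linearZ.
nra.
Qed.

End Solar.

(** * Nested balls of unbounded radii and their support functionals *)

Section NestedBalls.
Context {R : realType} {X : normedModType R}.
Implicit Types (x y k : X) (f : X -> R^o) (K : set X) (rho : nat -> R).

(** Here [z] lies on the segment from [x] to a nearest point [p], at distance [dist K x - r] from
    [p]; going back to [x] therefore gains at least [r]. *)
Lemma Erset_extend K r z : 0 < r -> Erset r K z ->
  exists2 x, `|x - z| = r & dist K z + r <= dist K x.
Proof.
move=> r0 [x [p [_ [Kp _] xpd rd ->]]]; exists x.
  by rewrite subKr !normrZ normfV normr_id mulVf ?mulr1 ?gtr0_norm // xpd; lra.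
rewrite -lerBrDr (le_trans (dist_le_norm _ Kp)) //.
have -> : x - r *: (`|x - p|^-1 *: (x - p)) - p =
    (1 - r * `|x - p|^-1) *: (x - p).
  by rewrite addrAC scalerBl scale1r scalerA.
have xp0 : 0 < `|x - p| by rewrite xpd; lra.
rewrite normrZ ger0_norm; last by rewrite subr_ge0 ler_pdivrMr // mul1r xpd ltW.
by rewrite mulrBl mul1r divfK ?gt_eqF // xpd.
Qed.

Lemma grow_ball K r y (s : R) : K !=set0 -> 0 < r ->
  dense_in (Erset r K) (~` K) -> 0 < s < dist K y ->
  exists y' s', [/\ s' < dist K y', `|y' - y| <= s' - s & s + r <= s'].
Proof.
(* One third of the slack [dist K y - s] pays for replacing [y] by a nearby [z] in [Erset r K], and
   the rest keeps the new inequality strict. *)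
move=> K0 r0 dE /andP[s0 sd]; pose e := (dist K y - s) / 3.
have e0 : 0 < e by rewrite divr_gt0 // subr_gt0.
have nKy : (~` K) y.
  by move=> /(dist_le_norm y); rewrite subrr normr0; lra.
have [z Ez yz] := dense_in_near dE nKy e0.
have [y' yz' dy'] := Erset_extend r0 Ez.
have := dist_lipschitz K0 y z; have := ler_distD z y' y.
rewrite yz' [`|z - y|]distrC => y'y dyz.
have se : dist K y = s + 3 * e by rewrite /e; lra.
by exists y', (s + r + e); split; lra.
Qed.

Lemma nested_balls K r x : K !=set0 -> closed K -> 0 < r ->
  dense_in (Erset r K) (~` K) -> ~ K x ->
  exists (y : nat -> X) rho, [/\ y 0%N = x, 0 < rho 0%N,
    forall n, `|y n.+1 - y n| <= rho n.+1 - rho n,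
    forall n, rho n <= dist K (y n) &
    forall n, r * n%:R <= rho n].
Proof.
move=> K0 Kc r0 dE nKx; have d0 := dist_gt0 K0 Kc nKx.
(* The guard makes the relation total, as dependent choice requires; [inv] shows afterwards that it
   always holds along the sequence. *)
pose next (a b : X * R) := 0 < a.2 < dist K a.1 ->
  [/\ b.2 < dist K b.1, `|b.1 - a.1| <= b.2 - a.2 & a.2 + r <= b.2].
have total a : {b | next a b}.
  apply: cid; have [va|va] := boolP (0 < a.2 < dist K a.1); last first.
    by exists a => /(negP va).
  have [y' [s' ys']] := grow_ball K0 r0 dE va.
  by exists (y', s').
have [g [g0 gS]] := dependent_choice total (x, dist K x / 2).
have inv n : 0 < (g n).2 < dist K (g n).1.
  elim: n => [|n IH]; first by rewrite g0 /=; apply/andP; split; lra.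
  by have [-> _] := gS n IH; case/andP: IH; rewrite andbT; lra.
exists (fun n => (g n).1), (fun n => (g n).2); split.
- by rewrite g0.
- by rewrite g0 /=; lra.
- by move=> n; have [] := gS n (inv n).
- by move=> n; have /andP[_ /ltW] := inv n.
- elim=> [|n IH]; first by rewrite mulr0 g0 /=; lra.
  by have [_ _] := gS n (inv n); rewrite -natr1; lra.
Qed.

Variables (y : nat -> X) (rho : nat -> R).
Hypothesis nested : forall n, `|y n.+1 - y n| <= rho n.+1 - rho n.

Lemma nested_le n m : (n <= m)%N -> `|y m - y n| <= rho m - rho n.
Proof.
elim: m => [|m IH]; first by rewrite leqn0 => /eqP ->; rewrite !subrr normr0.
rewrite leq_eqVlt => /predU1P[->|/IH nm]; first by rewrite !subrr normr0.
have := ler_distD (y m) (y m.+1) (y n); have := nested m; lra.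
Qed.

(** Hahn-Banach applies to the infimum of [F] over [n] and [t >= 0]. Anything below it is below the
    norm by [t = 0], and at most [- rho n] at [y n - k] by [t = 1]. *)
Lemma nested_balls_support k : (forall n, rho n <= `|y n - k|) ->
  exists f, [/\ linear f, forall w, f w <= `|w| &
    forall n, f (y n - k) <= - rho n].
Proof.
move=> rk; pose D := [set i : nat * R | 0 <= i.2].
pose F (i : nat * R) w := `|w - i.2 *: (y i.1 - k)| - i.2 * rho i.1.
have lb w : has_lbound [set F i w | i in D].
  exists (- `|w|) => _ [[n t] /= t0 <-]; rewrite /F /=.
  have := lerB_dist (t *: (y n - k)) w; rewrite normrZ ger0_norm // [X in _ <= X]distrC.
  have := ler_wpM2l t0 (rk n) => /=; lra.
(* Nestedness makes [F] decrease in the ball index, so two indices can be raised to their maximum in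
   the proof of subadditivity. *)
have Fmono n m t w : 0 <= t -> (n <= m)%N -> F (m, t) w <= F (n, t) w.
  move=> t0 nm; rewrite /F /=.
  have := ler_distD (w - t *: (y n - k)) (w - t *: (y m - k)) 0.
  rewrite !subr0; set A := `|w - _ - (w - _)|.
  have -> : A = t * `|y m - y n|.
    rewrite -[t in RHS]ger0_norm // -normrZ -[RHS]normrN -scalerN opprB.
    congr `|_|; rewrite opprB addrC addrA subrK -scalerBr; congr (_ *: _).
    by rewrite opprB addrA subrK.
  by have := ler_wpM2l t0 (nested_le nm); lra.
have [|f lf fF] := @hahn_banach R X (fun w => inf [set F i w | i in D]).
  apply: sublinear_inf => //; first by exists (0%N, 0); exact: lexx.
    move=> [n t] [m s] w v /= t0 s0.
    exists (maxn n m, t + s); first exact: addr_ge0.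
    apply: (@le_trans _ _ (F (maxn n m, t) w + F (maxn n m, s) v)).
      rewrite /F /= scalerDl opprD addrACA.
      have := ler_normD (w - t *: (y (maxn n m) - k)) (v - s *: (y (maxn n m) - k)).
      by lra.
    by rewrite lerD // Fmono // ?leq_maxl ?leq_maxr.
  move=> [n t] s w /= t0 s0; exists (n, s * t).
    exact: mulr_ge0 (ltW s0) t0.
  by rewrite /F /= -scalerA -scalerBr normrZ gtr0_norm //; lra.
have fle w i : D i -> f w <= F i w.
  by move=> Di; apply: le_trans (fF w) _; apply: ge_inf => //; exists i.
exists f; split=> // [w|n].
  by have := fle w (0%N, 0) (lexx _); rewrite /F scale0r mul0r !subr0.
have := fle (y n - k) (n, 1) ler01.
by rewrite /F /= scale1r mul1r subrr normr0 sub0r.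
Qed.

End NestedBalls.

(** * Convexity from rotundity of the dual *)

Section RotundDual.
Context {R : realType} {X : normedModType R}.
Implicit Types (f : X -> R^o) (K : set X).

(* Two norm-one functionals supporting the same nested balls of unbounded radii
   are almost normed by the same vectors [(y 0 - y n) / rho n], hence so is their
   mean, and rotundity makes them equal. *)
Lemma Erset_dense_convex K r : rotund_dual X -> K !=set0 -> closed K ->
  0 < r -> dense_in (Erset r K) (~` K) -> convex_set K.
Proof.
move=> rot K0 Kc r0 dE; apply: convex_setP => k1 k2 t Kk1 Kk2 t0 t1.
set x := (X in K X); apply: contrapT => nKx.
have [y [rho [y0 rho0 nested rhod rhor]]] := nested_balls K0 Kc r0 dE nKx.
have rk k : K k -> forall n, rho n <= `|y n - k|.
  by move=> Kk n; rewrite (le_trans (rhod n)) // dist_le_norm.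
have [f1 [l1 n1 s1]] := nested_balls_support nested (rk _ Kk1).
have [f2 [l2 n2 s2]] := nested_balls_support nested (rk _ Kk2).
have rho_gt0 n : 0 < rho n.
  have := nested_le nested (leq0n n); have := normr_ge0 (y n - y 0%N); lra.
pose C := `|y 0%N - k1| + `|y 0%N - k2|.
have far e : 0 < e -> exists2 n, C / rho n <= e & `|y 0%N - y n| <= rho n.
  (* Since [rho n >= r * n], any [n] above [C / (e * r)] works; the successor compensates for
     truncation. *)
  move=> e0; exists (Num.truncn (C / (e * r))).+1; last first.
    by rewrite distrC (le_trans (nested_le nested (leq0n _))) // gerBl ltW.
  rewrite ler_pdivrMr // -ler_pdivrMl //; apply: le_trans (rhor _).
  rewrite -ler_pdivrMl // mulrA -invfM mulrC [r * e]mulrC.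
  exact/ltW/truncnS_gt.
(* Write [y 0 - y n] as [(y 0 - k) - (y n - k)]: [f] is at least [- C] on the first term and at most
   [- rho n] on the second. *)
have near_norming f k : linear f -> (forall w, f w <= `|w|) ->
    (forall n, f (y n - k) <= - rho n) -> `|y 0%N - k| <= C ->
    forall n, 1 - C / rho n <= f ((rho n)^-1 *: (y 0%N - y n)).
  move=> lf fle fs kC n; have := fle (k - y 0%N); have := fs n.
  rewrite distrC in kC; move: lf kC => /linear_bundle[g ->].
  have -> : g ((rho n)^-1 *: (y 0%N - y n)) = (rho n)^-1 * g (y 0%N - y n).
    by rewrite linearZ.
  rewrite !linearB /= => kC gn gk.
  rewrite ler_pdivlMl // mulrBr mulr1 mulrCA divff ?gt_eqF // mulr1; lra.
have a1 := near_norming _ _ l1 n1 s1 ltac:(rewrite lerDl //).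
have a2 := near_norming _ _ l2 n2 s2 ltac:(rewrite lerDr //).
have norming f : linear f -> (forall w, f w <= `|w|) ->
    (forall n, 1 - C / rho n <= f ((rho n)^-1 *: (y 0%N - y n))) ->
    dual_norm f = 1.
  move=> lf fle fa; apply: dual_norm_eq1 => // e e0.
  have [n Cn yn] := far e e0; exists ((rho n)^-1 *: (y 0%N - y n)).
    by rewrite normrZ gtr0_norm ?invr_gt0 // ler_pdivrMl // mulr1.
  by apply: le_trans (fa n); rewrite lerD2l lerN2.
have f12 : f1 = f2.
  apply: contrapT => neq.
  have := rot f1 f2 (norm_le1_dual l1 n1) (norm_le1_dual l2 n2)
    (norming _ l1 n1 a1) (norming _ l2 n2 a2) neq.
  rewrite norming ?ltxx //.
  - by move=> a u v; rewrite l1 l2 /GRing.scale /=; ring.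
  - by move=> w; have := n1 w; have := n2 w; lra.
  - by move=> n; have := a1 n; have := a2 n; lra.
(* The common functional exceeds its value at [x] by at least [rho 0 > 0] at both [k1] and [k2],
   impossible for their convex combination [x]. *)
move: (s1 0%N) (s2 0%N); rewrite -f12 y0; move: l1 => /linear_bundle[g ->].
rewrite !linearB /=.
have -> : g x = t * g k1 + (1 - t) * g k2 by rewrite /x linearD !linearZ.
nra.
Qed.

End RotundDual.

Theorem theorem3p4 (R : realType) (X : completeNormedModType R) (K : set X)
    (K_nonempty : K !=set0) (K_closed : closed K) :
  [\/ uniformly_smooth_norm X /\ almost_sun K,
      [/\ LUR X, rotund_dual X,
          exists r : R, [/\ 0 < r, dense_in (Erset r K) (~` K) &
                            uniformly_smooth_on (Erset r K) (dist K)] &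
          forall x : X, ~ K x ->
            exists2 f : X -> R^o,
              gateaux_derivative (dist K) x f & dual_norm f = 1]
    | [/\ LUR X, frechet_smooth_norm X, rotund_dual X &
          exists r : R, [/\ 0 < r, dense_in (Erset r K) (~` K) &
                            uniformly_frechet_smooth_on (Erset r K) (dist K)]]] ->
  convex_set K.
Proof.
case=> [[us [_ sol]]|[_ rot [r [r0 dE _]] _]|[_ _ rot [r [r0 dE _]]]].
- exact: almost_sun_convex.
- exact: Erset_dense_convex rot _ _ r0 dE.
- exact: Erset_dense_convex rot _ _ r0 dE.
Qed.
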